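(* Every counter system $\mathcal{C}=(C,Q,\mathcal{T})$ induced by guarded synchronization steps is fully $\preceq_0$-compatible.
   Context: For $\mathbf{v}\in\mathbb{N}^Q$ let $|\mathbf{v}|=\sum_{q\in Q}\mathbf{v}(q)$ and let the support of $\mathbf{v}$ be $\mathrm{supp}(\mathbf{v})=\{q\in Q\mid\mathbf{v}(q)\ge1\}$. A counter system (CS) is a triple $\mathcal{C}=(C,Q,\mathcal{T})$ with $C$ a finite set (controller states), $Q$ a finite set (user states), and a size-preserving step relation $\mathcal{T}\subseteq(C\times\mathbb{N}^Q)\times(C\times\mathbb{N}^Q)$ ($|\mathbf{v}|=|\mathbf{v}'|$ whenever $((c,\mathbf{v}),(c',\mathbf{v}'))\in\mathcal{T}$). Write $(c,\mathbf{v})\to(c',\mathbf{v}')$ for $((c,\mathbf{v}),(c',\mathbf{v}'))\in\mathcal{T}$. A configuration $(c,\mathbf{v})$ represents one controller process in state $c$ and $\mathbf{v}(q)$ user processes in each state $q$. Order: $(c,\mathbf{v})\preceq_0(d,\mathbf{w})$ iff $c=d$ and, for all $q\in Q$, $\mathbf{v}(q)\le\mathbf{w}(q)$ and $(\mathbf{v}(q)=0\Leftrightarrow\mathbf{w}(q)=0)$. $\mathcal{C}$ is forward $\preceq_0$-compatible if whenever $(c,\mathbf{v})\to(c',\mathbf{v}')$ and $(c,\mathbf{v})\preceq_0(d,\mathbf{w})$, there is a step $(d,\mathbf{w})\to(d',\mathbf{w}')$ with $(c',\mathbf{v}')\preceq_0(d',\mathbf{w}')$. It is backward $\preceq_0$-compatible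 if whenever $(c,\mathbf{v})\to(c',\mathbf{v}')$ and $(c',\mathbf{v}')\preceq_0(d',\mathbf{w}')$, there is a step $(d,\mathbf{w})\to(d',\mathbf{w}')$ with $(c,\mathbf{v})\preceq_0(d,\mathbf{w})$. Fully $\preceq_0$-compatible means both. Guarded synchronization. Let $\Sigma$ be a finite set of labels. Local transitions have the form $p\xrightarrow{a,(G_\exists,G_\forall)}q$ with $a\in\Sigma$, $p,q\in C$ or $p,q\in Q$, and $G_\exists,G_\forall\subseteq C\cup Q$. A synchronization step on $a$ guarded by $(G_\exists,G_\forall)$ is enabled from $(c,\mathbf{v})$ only if $S=\mathrm{supp}(\mathbf{v})\cup\{c\}$ satisfies $S\cap G_\exists\ne\emptyset$ and $S\subseteq G_\forall$. In such a step every process (the controller and each user process) takes a transition labelled $a,(G_\exists,G_\forall)$ if one is available from its current state (choosing one if there are several), and otherwise stays in its current state. A CS is induced by guarded synchronization steps if $\mathcal{T}$ is the set of all such steps defined by some finite set of guarded synchronization transitions. *)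

(* Defs.v *)
From mathcomp Require Import all_boot.

Set Implicit Arguments.
Unset Strict Implicit.
Unset Printing Implicit Defensive.

Section CounterSystems.

Variables C Q : finType.

Definition vsize (v : {ffun Q -> nat}) : nat := \sum_q v q.

Definition supp (v : {ffun Q -> nat}) : {set Q} := [set q | 1 <= v q].

Definition config : Type := C * {ffun Q -> nat}.

Record counter_system := CounterSystem {
  step :> config -> config -> Prop;
  step_size : forall x y : config, step x y -> vsize x.2 = vsize y.2
}.

Definition preceq0 (x y : config) : Prop :=
  x.1 = y.1 /\
  forall q : Q, x.2 q <= y.2 q /\ (x.2 q = 0 <-> y.2 q = 0).

Definition forward_compatible (CS : counter_system) : Prop :=
  forall x x' y : config, CS x x' -> preceq0 x y ->
    exists y' : config, CS y y' /\ preceq0 x' y'.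

Definition backward_compatible (CS : counter_system) : Prop :=
  forall x x' y' : config, CS x x' -> preceq0 x' y' ->
    exists y : config, CS y y' /\ preceq0 x y.

Definition fully_compatible (CS : counter_system) : Prop :=
  forward_compatible CS /\ backward_compatible CS.

End CounterSystems.

Section GuardedSynchronization.

Variables C Q Sigma : finType.

(* (a, (G_exists, G_forall)); C and Q are taken disjoint, so C + Q is a sum. *)
Definition glabel : finType :=
  (Sigma * ({set (C + Q)%type} * {set (C + Q)%type}))%type.

(* [inl (p, l, q)] is a controller transition, [inr (p, l, q)] a user one. *)
Definition transition : finType := ((C * glabel * C) + (Q * glabel * Q))%type.

Definition label_of (t : transition) : glabel :=
  match t with inl (_, l, _) => l | inr (_, l, _) => l end.

Definition occupied (x : config C Q) : {set (C + Q)%type} :=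
  inl x.1 |: [set inr q | q in supp x.2].

Definition enabled (l : glabel) (x : config C Q) : bool :=
  (occupied x :&: l.2.1 != set0) && (occupied x \subset l.2.2).

(* A process that has a transition must take one; otherwise it stays. *)
Definition local_move (P : finType) (t : rel P) (p p' : P) : bool :=
  if [exists r, t p r] then t p p' else p' == p.

Definition ctrl_trans (D : {set transition}) (l : glabel) : rel C :=
  fun p q => inl (p, l, q) \in D.

Definition user_trans (D : {set transition}) (l : glabel) : rel Q :=
  fun p q => inr (p, l, q) \in D.

(* The user processes of v: v q of them in each state q, the current state of
   a process u being [tag u]. *)
Definition process (v : {ffun Q -> nat}) : finType := {q : Q & 'I_(v q)}.

(* The map f gives each user process its next state; different processes in
   the same state may choose different transitions. *)
Definition sync_step (D : {set transition}) (l : glabel) (x y : config C Q) :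
    Prop :=
  [/\ enabled l x,
      local_move (ctrl_trans D l) x.1 y.1 &
      exists f : process x.2 -> Q,
        (forall u : process x.2, local_move (user_trans D l) (tag u) (f u)) /\
        (forall q : Q, y.2 q = #|[set u : process x.2 | f u == q]|)].

(* Only labels carried by some transition of D give rise to steps. *)
Definition gsync_step (D : {set transition}) (x y : config C Q) : Prop :=
  exists2 t : transition, t \in D & sync_step D (label_of t) x y.

Definition induced_by_gsync (CS : counter_system C Q) : Prop :=
  exists D : {set transition},
    forall x y : config C Q, CS x y <-> gsync_step D x y.

(* Every finite set of guarded synchronization transitions does induce a
   counter system. *)
Lemma gsync_step_size (D : {set transition}) (x y : config C Q) :
  gsync_step D x y -> vsize x.2 = vsize y.2.
Proof.
case=> t _ [_ _ [f [_ fE]]]; rewrite /vsize.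
have -> : \sum_q x.2 q = #|process x.2|.
  by rewrite card_tagged sumnE big_map big_enum; apply: eq_bigr => q _; rewrite card_ord.
rewrite -sum1_card (partition_big f predT) //=.
apply: eq_bigr => q _; rewrite fE -sum1_card.
by apply: eq_bigl => u; rewrite inE.
Qed.

Definition gsync_system (D : {set transition}) : counter_system C Q :=
  CounterSystem (@gsync_step_size D).

End GuardedSynchronization.

(* Main.v *)
(** A step is a finite family of moves, each user process [u] going from [s u]
    to [t u].  Repeat each move [n u >= 1] times: source and target grow but
    keep their supports, so the guards still hold.  As every nonempty fibre of
    [s] (forward compatibility) or of [t] (backward compatibility) contains a
    move that may be repeated, the prescribed end of the step can be enlarged
    at will inside its support. *)
Require Import Defs.
From mathcomp Require Import all_boot.

Set Implicit Arguments.
Unset Strict Implicit.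
Unset Printing Implicit Defensive.

(** The condition that [preceq0] imposes at a single user state. *)
Definition enlarges (m n : nat) : Prop := m <= n /\ (m = 0 <-> n = 0).

Section WeightedFamilies.

Variables (P Q : finType).

Lemma card_copies (s : P -> Q) (n : P -> nat) (q : Q) :
  #|[set u : {p : P & 'I_(n p)} | s (tag u) == q]| = \sum_(p | s p == q) n p.
Proof.
rewrite -sum1dep_card.
rewrite (eq_bigr (fun p => \sum_(i < n p) 1)); last first.
  by move=> p _; rewrite sum1_card card_ord.
by rewrite sig_big_dep; apply: eq_bigl => u; rewrite andbT.
Qed.

(** Over each [q] the fibres of [s] and of [tag] both have size [v q], so numbering the fibres of
    [s] matches them. Any finite family with source counts [v] can thus stand for the user processes
    of [v]. *)
Lemma process_labelling (s : P -> Q) (v : {ffun Q -> nat}) :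
    (forall q, v q = #|[set p | s p == q]|) ->
  exists2 g : process v -> P, bijective g & forall u, s (g u) = tag u.
Proof.
move=> vE; pose g (u : process v) := enum_val (cast_ord (vE (tag u)) (tagged u)).
have sg u : s (g u) = tag u.
  by have := enum_valP (cast_ord (vE (tag u)) (tagged u)); rewrite inE => /eqP.
exists g => //; apply: inj_card_bij => [u1 u2 eg|].
  have := sg u1; rewrite eg sg; move: u1 u2 eg => [q i] [q' j] /= + eqq.
  by rewrite -{}eqq in i j * => /enum_val_inj/cast_ord_inj /= ->.
rewrite card_tagged sumnE big_map big_enum -sum1_card (partition_big s predT) //=.
by apply/eq_leq/eq_bigr => q _; rewrite sum1dep_card card_ord vE.
Qed.

(** One element of each nonempty fibre absorbs the whole surplus; over an empty fibre [w q = 0], so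
    there is no surplus to place. *)
Lemma enlarging_weights (s : P -> Q) (w : Q -> nat) :
    (forall q, enlarges #|[set p | s p == q]| (w q)) ->
  exists2 n : P -> nat,
    forall p, 0 < n p & forall q, w q = \sum_(p | s p == q) n p.
Proof.
move=> ws; pose F q := [set p | s p == q].
(* The pick depends only on the fibre of [p], so it singles out the same element for all members of
   that fibre. *)
pose extra p :=
  if [pick p' in F (s p)] == Some p then w (s p) - #|F (s p)| else 0.
exists (fun p => 1 + extra p) => // q.
have [le_sw sw0] := ws q.
rewrite big_split /= sum1dep_card -/(F q) -[LHS](subnKC le_sw); congr (_ + _).
have -> : \sum_(p | s p == q) extra p =
    \sum_(p | s p == q) if [pick p' in F q] == Some p then w q - #|F q| else 0.
  by apply: eq_bigr => p /eqP sp; rewrite /extra sp.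
case: pickP => [p0 | F0].
  rewrite inE => sp0; rewrite (bigD1 p0) //= eqxx big1 ?addn0 // => p /andP[_].
  by rewrite (inj_eq Some_inj) eq_sym => /negbTE->.
by rewrite big1 //; have [-> //] := sw0; apply: eq_card0.
Qed.

(** Each term is at least 1, so the sum dominates the size of the fibre and vanishes only when the
    fibre is empty. *)
Lemma weighted_fibre_enlarges (s : P -> Q) (n : P -> nat) (q : Q) :
  (forall p, 0 < n p) -> enlarges #|[set p | s p == q]| (\sum_(p | s p == q) n p).
Proof.
move=> n_gt0; rewrite -sum1dep_card.
have le_1n : \sum_(p | s p == q) 1 <= \sum_(p | s p == q) n p.
  by apply: leq_sum.
split=> //; split=> [|n0]; last by move: le_1n; rewrite n0 leqn0 => /eqP.
rewrite sum1dep_card => /eqP; rewrite cards_eq0 => /eqP s0.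
by rewrite big_pred0 // => p; have := in_set0 p; rewrite -s0 inE.
Qed.

End WeightedFamilies.

(** The copies of the moves have source counts [v], hence are labelled by the processes of [v]; each
    process makes the move that its label copies, which [M] allows. *)
Lemma weighted_moves (P Q : finType) (s t : P -> Q) (n : P -> nat) (M : rel Q)
    (v : {ffun Q -> nat}) :
    (forall p, M (s p) (t p)) -> (forall q, v q = \sum_(p | s p == q) n p) ->
  exists f : process v -> Q,
    (forall u, M (tag u) (f u)) /\
    forall q, \sum_(p | t p == q) n p = #|[set u | f u == q]|.
Proof.
move=> Mst vE; pose R : finType := {p : P & 'I_(n p)}.
have [|g bij_g sg] := @process_labelling R Q (fun u => s (tag u)) v.
  by move=> q; rewrite vE card_copies.
exists (fun u => t (tag (g u))); split=> [u | q]; first by rewrite -sg.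
rewrite -card_copies -(on_card_preimset (onW_bij _ bij_g)).
by apply: eq_card => u; rewrite !inE.
Qed.

Lemma preceq0_occupied (C Q : finType) (x y : config C Q) :
  preceq0 x y -> occupied x = occupied y.
Proof.
case=> xy1 xy2; rewrite /occupied xy1.
suff -> : supp x.2 = supp y.2 by [].
apply/setP=> q; rewrite !inE !lt0n; have [_ xy0] := xy2 q.
by congr (~~ _); apply/eqP/eqP => /xy0.
Qed.

Lemma preceq0_enabled (C Q Sigma : finType) (l : glabel C Q Sigma)
    (x y : config C Q) :
  preceq0 x y -> enabled l x = enabled l y.
Proof. by move=> xy; rewrite /enabled (preceq0_occupied xy). Qed.

Lemma card_process_at (Q : finType) (v : {ffun Q -> nat}) (q : Q) :
  #|[set u : process v | tag u == q]| = v q.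
Proof. by rewrite (card_copies id v) big_pred1_eq. Qed.

Theorem lemma4 (C Q Sigma : finType) (CS : counter_system C Q) :
  induced_by_gsync Sigma CS -> fully_compatible CS.
Proof.
case=> D CSE; split=> [x x' y | x x' y'] /CSE[tr trD [en ctrl [f [fM fE]]]] xy.
  (* Forward: the source [y] is prescribed, so the weights are chosen along the fibres of [tag]. *)
  have [n n_gt0 yE] : exists2 n : process x.2 -> nat,
      forall u, 0 < n u & forall q, y.2 q = \sum_(u | tag u == q) n u.
    by apply: enlarging_weights => q; rewrite card_process_at; apply: xy.2.
  have [g [gM gE]] := weighted_moves fM yE.
  exists (x'.1, [ffun q => \sum_(u | f u == q) n u]); split.
    apply/CSE; exists tr => //; split; first by rewrite -(preceq0_enabled _ xy).
      by have [<-] := xy.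
    by exists g; split=> // q; rewrite ffunE gE.
  by split=> //= q; rewrite ffunE fE; apply: weighted_fibre_enlarges.
(* Backward: the target [y'] is prescribed, so the weights are chosen along the fibres of [f]. *)
have [n n_gt0 yE] : exists2 n : process x.2 -> nat,
    forall u, 0 < n u & forall q, y'.2 q = \sum_(u | f u == q) n u.
  by apply: enlarging_weights => q; rewrite -fE; apply: xy.2.
(* The source counts of the repeated moves. *)
pose w := [ffun q => \sum_(u : process x.2 | tag u == q) n u].
have xw : preceq0 x (x.1, w).
  split=> //= q; rewrite ffunE -[x.2 q]card_process_at.
  exact: weighted_fibre_enlarges.
have [g [gM gE]] := weighted_moves (v := w) fM (ffunE _).
exists (x.1, w); split=> //; apply/CSE; exists tr => //.
split; first by rewrite -(preceq0_enabled _ xw).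
  by have [<-] := xy.
by exists g; split=> // q; rewrite yE gE.
Qed.
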